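(* Let $n\ge 2$, let $z_1,\dots,z_n$ be distinct complex numbers, let $a_1,\dots,a_n>0$ with $\sum_{i=1}^n a_i=1$, and let $w_1,\dots,w_{n-1}$ be the zeros, counted with multiplicity, of $f(z)=\sum_{i=1}^n\frac{a_i}{z-z_i}$. For $1\le m\le k\le n-1$, $\lambda\in\mathbb{C}\setminus\{0\}$ and $\mu\in\mathbb{C}$ let $$\omega_m[r_1,\dots,r_k](\lambda,\mu)=\Pi_{k,m}(\lambda w_{r_1}+\mu,\dots,\lambda w_{r_k}+\mu),\qquad \zeta_m[s_1,\dots,s_k](\lambda,\mu)=\Pi_{k,m}(\lambda z_{s_1}+\mu,\dots,\lambda z_{s_k}+\mu),$$ $$W_m^{[k]}(\lambda,\mu)=\big(\omega_m[r_1,\dots,r_k](\lambda,\mu)\big)_{1\le r_1<\dots<r_k\le n-1},\qquad Z_m^{[k]}(\lambda,\mu)=\big(\zeta_m[s_1,\dots,s_k](\lambda,\mu)\big)_{1\le s_1<\dots<s_k\le n},$$ $$\mathbf{a}^{[k]}=\Big(\tbinom{n-1}{k}^{-1},\dots,\tbinom{n-1}{k}^{-1}\Big)\in\mathbb{R}^{\binom{n-1}{k}},\qquad \mathbf{b}^{[k]}=\Big(\tbinom{n-1}{k}^{-1}\big(1-\sum_{i=1}^k a_{s_i}\big)\Big)_{1\le s_1<\dots<s_k\le n}\in\mathbb{R}^{\binom{n}{k}},$$ with all index sets of $k$-tuples ordered lexicographically. Then for every $k\in\{1,\dots,n-1\}$ there exists a $\binom{n-1}{k}\times\binom{n}{k}$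 row stochastic matrix $R_k$ such that $$W_m^{[k]}(\lambda,\mu)^T=R_kZ_m^{[k]}(\lambda,\mu)^T\quad\text{and}\quad\mathbf{b}^{[k]}=\mathbf{a}^{[k]}R_k$$ for all $1\le m\le k$, $\lambda\in\mathbb{C}\setminus\{0\}$ and $\mu\in\mathbb{C}$. In particular, for all such $k,m,\lambda,\mu$ and every convex function $\Phi:\mathbb{C}\to\mathbb{R}$, $$\sum_{1\le r_1<\dots<r_k\le n-1}\Phi\big(\omega_m[r_1,\dots,r_k](\lambda,\mu)\big)\le\sum_{1\le s_1<\dots<s_k\le n}\Big(1-\sum_{i=1}^k a_{s_i}\Big)\Phi\big(\zeta_m[s_1,\dots,s_k](\lambda,\mu)\big).$$
   Context: $\Pi_{k,m}$ denotes the $m$th elementary symmetric function in $k$ variables. $\mathbb{C}$ is identified with $\mathbb{R}^2$ when speaking of convex functions. A row stochastic matrix is a matrix with nonnegative real entries all of whose row sums equal $1$. *)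

(* Defs.v *)
From HB Require Import structures.
From mathcomp Require Import all_boot all_order all_algebra.
From mathcomp Require Import generic_quotient fraction.
From mathcomp Require Import complex mpoly.

Set Implicit Arguments.
Unset Strict Implicit.
Unset Printing Implicit Defensive.

Import Order.TTheory GRing.Theory Num.Theory.
Local Open Scope ring_scope.

(* The rational function \sum_i a_i / (z - z_i), as an element of the field of
   rational functions C(X). *)
Definition pole_sum (R : rcfType) (n : nat) (a : 'I_n -> R) (z : 'I_n -> R[i]) :
    {fraction {poly R[i]}} :=
  \sum_(i < n) tofrac ((a i)%:C%C)%:P / tofrac ('X - (z i)%:P).

(* The multiplicity of c as a zero of a nonzero rational function g: the excess
   of the order of vanishing at c of a numerator over that of a denominator.
   The truncated subtraction yields 0 when c is a pole of g.  By
   [zero_multE] the representative chosen by [repr] is irrelevant. *)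
Definition zero_mult (F : fieldType) (g : {fraction {poly F}}) (c : F) : nat :=
  (mup c \n_(repr g) - mup c \d_(repr g))%N.

Lemma zero_multE (F : fieldType) (p q : {poly F}) (c : F) :
  p != 0 -> q != 0 ->
  zero_mult (tofrac p / tofrac q) c = (mup c p - mup c q)%N.
Proof.
move=> p0 q0; rewrite /zero_mult; set g := _ / _.
have numden (h : {fraction {poly F}}) :
    h * tofrac \d_(repr h) = tofrac \n_(repr h).
  rewrite -[X in X * _]reprK; move: (repr h) => x.
  unlock FracField.tofrac; rewrite -[LHS]FracField.pi_mul.
  apply/eqmodP; rewrite /= FracField.equivfE.
  rewrite /FracField.mulf !numden_Ratio ?mulf_neq0 ?denom_ratioP ?oner_neq0 //.
  by rewrite [eqbRHS]mulrC mulrA.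
have d0 : \d_(repr g) != 0 by apply: denom_ratioP.
have q0' : tofrac q != 0 by rewrite tofrac_eq0.
have E : \n_(repr g) * q = p * \d_(repr g).
  apply/eqP; rewrite -tofrac_eq !tofracM -numden.
  by rewrite /g mulrAC divfK.
have n0 : \n_(repr g) != 0.
  apply: contraNneq (mulf_neq0 p0 d0) => n0.
  by rewrite -E n0 mul0r.
have := congr1 (mup c) E; rewrite !mupM //.
move=> H; rewrite -(subnDr (mup c q)) H.
by rewrite [X in (_ - X)%N]addnC subnDr.
Qed.

(* w lists the zeros of g counted with multiplicity. *)
Definition zeros_of (F : fieldType) (p : nat) (g : {fraction {poly F}})
    (w : 'I_p -> F) : Prop :=
  forall c : F, #|[set j | w j == c]| = zero_mult g c.

Definition incr_tuples (n k : nat) : {set k.-tuple 'I_n} :=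
  [set s : k.-tuple _ | sorted ltn (map val s)].

Lemma card_incr_tuples (n k : nat) : #|incr_tuples n k| = 'C(n, k).
Proof. exact: card_ltn_sorted_tuples. Qed.

(* The i-th strictly increasing k-tuple in the lexicographic order:
   [Order.enum_val] is monotone for the order of [k.-tuplelexi]. *)
Definition lex_tuple (n k : nat) (i : 'I_('C(n, k))) : k.-tuple 'I_n :=
  @Order.enum_val _ (k.-tuplelexi 'I_n) (mem (incr_tuples n k))
    (cast_ord (esym (card_incr_tuples n k)) i).

Lemma lex_tuple_lt (n k : nat) (i j : 'I_('C(n, k))) :
  ((lex_tuple i : k.-tuplelexi 'I_n) < lex_tuple j)%O = (i < j)%N.
Proof.
have tot : total (<=%O : rel (k.-tuplelexi 'I_n)) := @le_total _ _.
by rewrite ltNge /lex_tuple Order.le_enum_val // -ltNge ltEord.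
Qed.

(* \Pi_{k,m}(lambda x_{s_1} + mu, ..., lambda x_{s_k} + mu); this is omega_m[s]
   for x := w and zeta_m[s] for x := z. *)
Definition esym_affine (R : rcfType) (n k m : nat) (x : 'I_n -> R[i])
    (lambda mu : R[i]) (s : k.-tuple 'I_n) : R[i] :=
  (mesym k R[i] m).@[fun i => lambda * x (tnth s i) + mu].

Definition esym_row (R : rcfType) (n k m : nat) (x : 'I_n -> R[i])
    (lambda mu : R[i]) : 'rV[R[i]]_('C(n, k)) :=
  \row_i esym_affine m x lambda mu (lex_tuple i).

Definition avec (R : rcfType) (n k : nat) : 'rV[R]_('C(n.-1, k)) :=
  const_mx ('C(n.-1, k)%:R^-1).

Definition bvec (R : rcfType) (n k : nat) (a : 'I_n -> R) :
    'rV[R]_('C(n, k)) :=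
  \row_j ('C(n.-1, k)%:R^-1 * (1 - \sum_(i < k) a (tnth (lex_tuple j) i))).

Definition row_stochastic (R : numDomainType) (p q : nat) (A : 'M[R]_(p, q)) :
    Prop :=
  (forall i j, 0 <= A i j) /\ (forall i, \sum_j A i j = 1).

(* Main.v *)
(* Let v = (sqrt a_1, ..., sqrt a_n), a unit vector, and let the rows of the
   (n-1) x n matrix U be an orthonormal basis of the complement of v, so that
   U^* U = 1 - v^* v.  The compression U diag(z) U^* of diag(z) has
   characteristic polynomial \sum_i a_i \prod_(j != i) (X - z_j), hence
   eigenvalues w, and by Schur's theorem U can be chosen so that it is
   triangular with diagonal w.  Computing the principal minors of
   X - lambda U diag(z) U^* - mu by the Cauchy-Binet formula gives
     \prod_(i <= k) (X - lambda w_(r_i) - mu)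
       = \sum_s |det U[r, s]|^2 \prod_(i <= k) (X - lambda z_(s_i) - mu),
   and comparing coefficients shows that R_k(r, s) = |det U[r, s]|^2 works for
   all m at once.  By Cauchy-Binet again the row sums of R_k are principal
   minors of U U^* = 1 and its column sums are the principal minors
   1 - \sum_i a_(s_i) of U^* U.  The inequality is Jensen's along the rows. *)

Require Import Defs.
From HB Require Import structures.
From mathcomp Require Import all_boot all_order all_algebra.
From mathcomp Require Import perm fraction interval_inference.
From mathcomp Require Import complex mpoly.
From mathcomp Require Import classical_sets reals convex.

Set Implicit Arguments.
Unset Strict Implicit.
Unset Printing Implicit Defensive.

Import Order.TTheory GRing.Theory Num.Theory.
Local Open Scope ring_scope.
Local Open Scope sesquilinear_scope.

(** * Increasing tuples and the Cauchy-Binet formula *)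

Lemma incr_tuple_inj (n k : nat) (s : k.-tuple 'I_n) :
  s \in incr_tuples n k -> injective (tnth s).
Proof.
rewrite inE => s_incr; apply/tuple_uniqP.
rewrite -(map_inj_uniq val_inj).
exact: sorted_uniq ltn_trans ltnn _ s_incr.
Qed.

Lemma incr_tuple_eq (n k : nat) (s t : k.-tuple 'I_n) :
  s \in incr_tuples n k -> t \in incr_tuples n k -> s =i t -> s = t.
Proof.
rewrite !inE => s_incr t_incr eq_st; apply/val_inj/(inj_map val_inj).
apply: (irr_sorted_eq ltn_trans ltnn s_incr t_incr) => x.
by apply/mapP/mapP => -[y y_in ->]; exists y; rewrite ?eq_st // -eq_st.
Qed.

Definition comp_perm (n k : nat) (p : k.-tuple 'I_n * 'S_k) :
    {ffun 'I_k -> 'I_n} :=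
  [ffun i => tnth p.1 (p.2 i)].

Lemma comp_perm_inj (n k : nat) :
  {in [pred p : k.-tuple 'I_n * 'S_k | p.1 \in incr_tuples n k] &,
    injective (@comp_perm n k)}.
Proof.
move=> [s sg] [t tg] s_ok t_ok.
have {s_ok}s_incr : s \in incr_tuples n k := s_ok.
have {t_ok}t_incr : t \in incr_tuples n k := t_ok.
move=> /ffunP eq_st.
have {}eq_st i : tnth s (sg i) = tnth t (tg i).
  by have := eq_st i; rewrite !ffunE.
have E : s = t.
  apply: incr_tuple_eq => // x; apply/tnthP/tnthP => -[i ->].
    by exists (tg (perm_inv sg i)); rewrite -eq_st permKV.
  by exists (sg (perm_inv tg i)); rewrite eq_st permKV.
rewrite -E in eq_st *; congr (_, _); apply/permP => i.
exact: incr_tuple_inj s_incr _ _ (eq_st i).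
Qed.

(** By counting: [comp_perm] is injective on these pairs and its values are injective maps, and both
    sides have ['C(n, k)] times k! elements. *)
Lemma injective_ffunE (n k : nat) :
  [set f : {ffun 'I_k -> 'I_n} | injectiveb f] =
  [set comp_perm p | p in [pred p | p.1 \in incr_tuples n k]].
Proof.
apply/esym/eqP; rewrite eqEcard; apply/andP; split.
  apply/fintype.subsetP => _ /imsetP[[s sg] s_incr ->].
  rewrite inE; apply/injectiveP => i j; rewrite !ffunE.
  by move/(incr_tuple_inj s_incr)/perm_inj.
rewrite card_inj_ffuns !card_ord card_in_imset; last exact: comp_perm_inj.
  rewrite (eq_card (B := [predX incr_tuples n k & 'S_k])) => [|p].
    by rewrite cardX card_incr_tuples card_Sn bin_ffact.
  by rewrite !inE andbT.
Qed.

(* Expand over all maps 'I_k -> 'I_n: the non-injective ones contribute 0, and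
   the others factor uniquely as an increasing tuple after a permutation. *)
Lemma det_mulmx_diag (R : comNzRingType) (n k : nat) (A : 'M[R]_(k, n))
    (d : 'I_n -> R) (B : 'M[R]_(n, k)) :
  \det (A *m diag_mx (\row_i d i) *m B) =
  \sum_(s in incr_tuples n k)
    \det (colsub (tnth s) A) * \det (rowsub (tnth s) B) *
    \prod_(i < k) d (tnth s i).
Proof.
pose F (f : {ffun 'I_k -> 'I_n}) :=
  (\prod_i (A i (f i) * d (f i))) * \det (rowsub f B).
transitivity (\sum_f F f).
  rewrite /determinant.
  under eq_bigr => sg _.
    under eq_bigr => i _.
      rewrite mxE; under eq_bigr do rewrite mul_mx_diag !mxE.
      over.
    rewrite bigA_distr_bigA big_distrr /=.
    over.
  rewrite exchange_big; apply: eq_bigr => f _ /=; rewrite /F /determinant.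
  rewrite big_distrr; apply: eq_bigr => sg _ /=.
  rewrite mulrCA big_split /=; congr (_ * (_ * _)).
  by apply: eq_bigr => i _; rewrite mxE.
rewrite (bigID (fun f : {ffun 'I_k -> 'I_n} => injectiveb f)) /=.
rewrite addrC big1 ?add0r => [|f /injectivePn[i [j ij fij]]]; last first.
  rewrite /F (determinant_alternate ij) ?mulr0 // => l.
  by rewrite !mxE fij.
transitivity (\sum_(f in [set f : {ffun 'I_k -> 'I_n} | injectiveb f]) F f).
  by apply: eq_bigl => f; rewrite inE.
rewrite injective_ffunE big_imset /=; last exact: comp_perm_inj.
rewrite (eq_bigl (fun p => (p.1 \in incr_tuples n k) && true)); last first.
  by move=> p; rewrite andbT.
rewrite -(pair_big _ xpredT (fun s sg => F (comp_perm (s, sg)))) /=.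
apply: eq_bigr => s _.
rewrite [\det (colsub _ _)]/determinant !big_distrl /=.
apply: eq_bigr => sg _; rewrite /F.
have -> : rowsub (comp_perm (s, sg)) B = row_perm sg (rowsub (tnth s) B).
  by apply/matrixP => i j; rewrite !mxE ffunE.
rewrite row_permE det_mulmx det_perm.
have -> : \prod_i (A i (comp_perm (s, sg) i) * d (comp_perm (s, sg) i)) =
    \prod_i colsub (tnth s) A i (sg i) * \prod_i d (tnth s i).
  rewrite [X in _ * X](reindex_perm sg) -big_split /=.
  by apply: eq_bigr => i _; rewrite mxE ffunE.
by rewrite mulrACA [X in X * _]mulrC [X in _ * X]mulrC mulrA.
Qed.

Lemma cauchy_binet (R : comNzRingType) (n k : nat) (A : 'M[R]_(k, n))
    (B : 'M[R]_(n, k)) :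
  \det (A *m B) =
  \sum_(s in incr_tuples n k)
    \det (colsub (tnth s) A) * \det (rowsub (tnth s) B).
Proof.
have := det_mulmx_diag A (fun=> 1) B.
rewrite (_ : \row__ _ = const_mx 1); last by apply/rowP => i; rewrite !mxE.
rewrite diag_const_mx mulmx1 => ->; apply: eq_bigr => s _.
by rewrite big1 ?mulr1.
Qed.

(** * Determinants of rank-one perturbations and of triangular submatrices *)

Lemma det_one_sub_outer (R : comNzRingType) (k : nat) (c : 'cV[R]_k)
    (u : 'rV[R]_k) : \det (1%:M - c *m u) = 1 - (u *m c) 0 0.
Proof.
pose M : 'M[R]_(1 + k) := block_mx 1%:M u c 1%:M.
pose N : 'M[R]_(1 + k) := block_mx 1%:M 0 (- c) 1%:M.
have detN : \det N = 1 by rewrite det_lblock !det1 mulr1.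
(* Both [N *m M] and [M *m N] are block upper triangular; the first exhibits the k x k determinant,
   the second the scalar. *)
transitivity (\det (N *m M)).
  rewrite mulmx_block !mul1mx !mul0mx !addr0 mulNmx mulmx1 addNr.
  by rewrite det_ublock det1 mul1r mulNmx addrC.
rewrite det_mulmx mulrC -det_mulmx.
rewrite mulmx_block !mul1mx !mulmx1 !mulmx0 !add0r subrr mulmxN.
by rewrite det_ublock det1 mulr1 det_mx11 !mxE.
Qed.

(* Stated up to a reordering [h] of the rows and columns: the eigenvalues on
   the diagonal of a Schur form appear in an uncontrolled order. *)
Lemma det_mxsub_trig (R : comNzRingType) (p k : nat) (M : 'M[R]_p)
    (h : 'I_p -> nat) (f : 'I_k -> 'I_p) :
  injective h -> injective f ->
  (forall i j, (h i < h j)%N -> M i j = 0) ->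
  \det (mxsub f f M) = \prod_i M (f i) (f i).
Proof.
move=> h_inj f_inj M_trig; rewrite /determinant (bigD1 (1%g : 'S_k)) //=.
rewrite [X in _ + X]big1 => [|sg sg_neq1].
  rewrite addr0 odd_perm1 mul1r; apply: eq_bigr => i _.
  by rewrite mxE perm1.
case: (pickP (fun i => h (f i) < h (f (sg i)))%N) => [i hi|no].
  by rewrite (bigD1 i) //= mxE M_trig // mul0r mulr0.
have le i : (h (f (sg i)) <= h (f i))%N by rewrite leqNgt no.
(* Without a strict increase, [h \o f \o sg] lies pointwise below [h \o f] with the same sum, so the
   two agree and [sg] is the identity. *)
case/eqP: sg_neq1; apply/permP => i; rewrite perm1.
have /eqP : \sum_i h (f (sg i)) = \sum_i h (f i).
  by rewrite [RHS](reindex_perm sg).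
have /leqif_sum := fun j (_ : xpredT j) => leqif_eq (le j).
by case=> _ -> /forallP/(_ i)/eqP/h_inj/f_inj.
Qed.

(** * Unitary completion and squared minors *)

Lemma unitary_completion (C : numClosedFieldType) (p : nat)
    (v : 'rV[C]_p.+1) :
  v \is unitarymx ->
  exists2 U : 'M[C]_(p, p.+1),
    U \is unitarymx & U ^t* *m U = 1%:M - v ^t* *m v.
Proof.
move=> v_unit.
(* Gram-Schmidt applied to [v] padded with zero rows gives a full unitary matrix; its last p rows
   serve as [U]. *)
pose M : 'M[C]_(1 + p, p.+1) := schmidt (col_mx v 0).
have M_unit : M \is unitarymx by apply: schmidt_unitarymx.
pose r := usubmx M; pose U := dsubmx M.
have defM : M = col_mx r U by rewrite vsubmxK.
have MtM := unitarymxP M_unit.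
rewrite defM tr_col_mx map_row_mx mul_col_row scalar_mx_block in MtM.
have [rr _ _ UU] := eq_block_mx MtM.
have MM : r ^t* *m r + U ^t* *m U = 1%:M :> 'M_p.+1.
  rewrite -mul_row_col -map_row_mx -tr_col_mx -defM.
  by apply: mulmx1C; apply/unitarymxP.
exists U; first exact/unitarymxP.
suff <- : r ^t* *m r = v ^t* *m v by rewrite -MM addrC addKr.
(* The first row [r] is tied to [v] only up to a scalar [c]; as [c] has modulus 1, it cancels in the
   projection [v ^t* *m v]. *)
have [c defv] : exists c : 'M[C]_1, v = c *m r.
  apply/submxP; have := row_schmidt_sub (col_mx v 0) (lshift p ord0).
  rewrite rowKu row_id => /submx_trans; apply.
  apply/sumsmx_subP => i i_le0; rewrite genmxE.
  have -> : i = lshift p ord0 by apply/val_inj/eqP; rewrite -leqn0.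
  by rewrite -/M defM rowKu row_id.
have cc : c *m c ^t* = 1%:M.
  have /unitarymxP := v_unit.
  by rewrite defv trmx_mul map_mxM mulmxA -(mulmxA c) rr mulmx1.
by rewrite defv trmx_mul map_mxM mulmxA -(mulmxA (r ^t*)) (mulmx1C cc) mulmx1.
Qed.

Lemma conj_mxsub (C : numClosedFieldType) (m n m' n' : nat)
    (f : 'I_m' -> 'I_m) (g : 'I_n' -> 'I_n) (U : 'M[C]_(m, n)) :
  mxsub g f (U ^t*) = (mxsub f g U) ^t*.
Proof. by apply/matrixP => i j; rewrite !mxE. Qed.

Lemma det_conj_tr (C : numClosedFieldType) (k : nat) (M : 'M[C]_k) :
  \det (M ^t*) = (\det M)^*.
Proof. by rewrite det_map_mx det_tr. Qed.

(* The entry R_k(r, s) of the stochastic matrix of the theorem. *)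
Definition minor_weight (C : numClosedFieldType) (m n k : nat)
    (U : 'M[C]_(m, n)) (r : 'I_k -> 'I_m) (s : 'I_k -> 'I_n) : C :=
  \det (mxsub r s U) * (\det (mxsub r s U))^*.

Lemma minor_weight_ge0 (C : numClosedFieldType) (m n k : nat)
    (U : 'M[C]_(m, n)) (r : 'I_k -> 'I_m) (s : 'I_k -> 'I_n) :
  0 <= minor_weight U r s.
Proof. exact: mul_conjC_ge0. Qed.

(** Cauchy-Binet with a diagonal factor in the middle. The morphism [phi] allows polynomial
    diagonals through [polyC], as well as scalar ones through [idfun]. *)
Lemma det_compression (C : numClosedFieldType) (R : comNzRingType)
    (phi : {rmorphism C -> R}) (m n k : nat) (U : 'M[C]_(m, n))
    (d : 'I_n -> R) (r : 'I_k -> 'I_m) :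
  \det (mxsub r r (map_mx phi U *m diag_mx (\row_i d i) *m
                     map_mx phi (U ^t*))) =
  \sum_(s in incr_tuples n k)
     phi (minor_weight U r (tnth s)) * \prod_(i < k) d (tnth s i).
Proof.
rewrite mxsub_mul -mul_rowsub_mx det_mulmx_diag; apply: eq_bigr => s _.
congr (_ * _); rewrite /minor_weight rmorphM; congr (_ * _).
  by rewrite -mxsubcr -map_mxsub det_map_mx.
by rewrite -mxsubrc -map_mxsub conj_mxsub det_map_mx det_conj_tr.
Qed.

Lemma det_mxsub_proj (C : numClosedFieldType) (n k : nat) (v : 'rV[C]_n)
    (s : 'I_k -> 'I_n) :
  injective s ->
  \det (mxsub s s (1%:M - v ^t* *m v)) =
  1 - \sum_(i < k) v 0 (s i) * (v 0 (s i))^*.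
Proof.
move=> s_inj.
have -> : mxsub s s (1%:M - v ^t* *m v) =
    1%:M - (colsub s v) ^t* *m colsub s v.
  apply/matrixP => i j; rewrite !mxE (inj_eq s_inj); congr (_ - _).
  by apply: eq_bigr => l _; rewrite !mxE.
rewrite det_one_sub_outer mxE; congr (_ - _).
by apply: eq_bigr => i _; rewrite !mxE.
Qed.

Lemma sum_minor_weight (C : numClosedFieldType) (m n k : nat)
    (U : 'M[C]_(m, n)) (s : 'I_k -> 'I_n) :
  \sum_(r in incr_tuples m k) minor_weight U (tnth r) s =
  \det (mxsub s s (U ^t* *m U)).
Proof.
rewrite mxsub_mul cauchy_binet; apply: eq_bigr => r _.
by rewrite -mxsubcr -mxsubrc conj_mxsub det_conj_tr mulrC.
Qed.

(** * Compressions of a diagonal matrix *)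

Lemma incr_tuples_omit (p : nat) :
  incr_tuples p.+1 p = [set [tuple lift i j | j < p] | i : 'I_p.+1].
Proof.
apply/esym/eqP; rewrite eqEcard; apply/andP; split.
  apply/fintype.subsetP => _ /imsetP[i _ ->]; rewrite inE /= -map_comp.
  rewrite (eq_map (g := bump i \o val)) // map_comp val_enum_ord.
  apply: homo_sorted (iota_ltn_sorted 0 p) => x y /=.
  by rewrite !ltnNge leq_bump2.
rewrite card_incr_tuples binSn card_imset ?card_ord // => i j.
(* The index [i] is recovered from its tuple as the only one missing from it. *)
move=> /(congr1 (fun t : p.-tuple _ => i \in t)).
have lift_in (l l' : 'I_p.+1) : (l \in [tuple lift l' k | k < p]) = (l != l').
  apply/tnthP/idP => [[k ->]|].
    by rewrite tnth_mktuple eq_sym neq_lift.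
  rewrite eq_sym => /unlift_some[k -> _].
  by exists k; rewrite tnth_mktuple.
by rewrite !lift_in eqxx => /esym/negbFE/eqP.
Qed.

(** This is [det_compression] at full height k = p. The tuple omitting [i] has as weight a principal
    minor of [1%:M - v ^t* *m v], namely 1 minus the squared moduli of the other entries of [v],
    which is that of [v 0 i]. *)
Lemma char_poly_compression (C : numClosedFieldType) (p : nat)
    (U : 'M[C]_(p, p.+1)) (v : 'rV[C]_p.+1) (z : 'I_p.+1 -> C) :
  U \is unitarymx -> v \is unitarymx -> U ^t* *m U = 1%:M - v ^t* *m v ->
  char_poly (U *m diag_mx (\row_i z i) *m U ^t*) =
  \sum_i (v 0 i * (v 0 i)^*)%:P * \prod_(j < p) ('X - (z (lift i j))%:P).
Proof.
move=> /unitarymxP UU /unitarymxP vv UV.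
have vv1 : \sum_i v 0 i * (v 0 i)^* = 1.
  have /matrixP/(_ 0 0) := vv; rewrite !mxE => vv_eq; rewrite -[RHS]vv_eq.
  by apply: eq_bigr => i _; rewrite !mxE.
pose V := map_mx polyC U; pose W := map_mx polyC (U ^t*).
have VW : V *m W = 1%:M by rewrite -map_mxM UU map_mx1.
transitivity (\det (mxsub id id
    (V *m diag_mx (\row_i ('X - (z i)%:P)) *m W))).
  rewrite mxsub_eq_id // /char_poly /char_poly_mx !map_mxM map_diag_mx.
  have -> : \row_i ('X - (z i)%:P) =
      const_mx 'X - map_mx polyC (\row_i z i) :> 'rV[{poly C}]_p.+1.
    by apply/rowP => i; rewrite !mxE.
  rewrite linearB /= diag_const_mx mulmxBr mulmxBl.
  by rewrite mul_mx_scalar -scalemxAl VW scalemx1.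
rewrite det_compression incr_tuples_omit big_imset /=; last first.
  apply/imset_injP; rewrite -incr_tuples_omit card_incr_tuples binSn.
  by rewrite cardT size_enum_ord.
apply: eq_bigr => i _; congr (_%:P * _); last first.
  by apply: eq_bigr => j _; rewrite tnth_mktuple.
(* The columns [s] of [U] form a square matrix, so its squared minor is a single determinant of a
   product. *)
set s := tnth _; transitivity (\det (mxsub s s (U ^t* *m U))).
  rewrite mxsub_mul det_mulmx /minor_weight mulrC; congr (_ * _).
  by rewrite -det_conj_tr -conj_mxsub.
rewrite UV det_mxsub_proj; last first.
  by move=> j k; rewrite /s !tnth_mktuple => /lift_inj.
rewrite -vv1 (bigD1_ord i) //=; apply/eqP; rewrite subr_eq; apply/eqP.
by congr (_ + _); apply: eq_bigr => j _; rewrite /s tnth_mktuple.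
Qed.

(** Schur's theorem yields a triangular form whose diagonal agrees with [w] only as a multiset.
    Permuting the rows of [U] aligns it with [w], and [h] records the order in which the matrix
    stays triangular. *)
Lemma triangular_compression (C : numClosedFieldType) (p : nat)
    (v : 'rV[C]_p.+1) (z : 'I_p.+1 -> C) (w : 'I_p -> C) :
  (0 < p)%N -> v \is unitarymx ->
  \sum_i (v 0 i * (v 0 i)^*)%:P * \prod_(j < p) ('X - (z (lift i j))%:P) =
    \prod_(j < p) ('X - (w j)%:P) ->
  exists (U : 'M[C]_(p, p.+1)) (h : 'I_p -> nat),
    let T := U *m diag_mx (\row_i z i) *m U ^t* in
    [/\ injective h, U \is unitarymx, U ^t* *m U = 1%:M - v ^t* *m v,
        forall i, T i i = w i & forall i j, (h i < h j)%N -> T i j = 0].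
Proof.
move=> p_gt0 v_unit sum_prod.
have [U0 U0_unit U0V] := unitary_completion v_unit.
have [Q Q_unit] := Schur (U0 *m diag_mx (\row_i z i) *m U0 ^t*) p_gt0.
rewrite /similar_to conjymx // => T_trig.
pose U1 := Q *m U0.
have U1_unit : U1 \is unitarymx by apply: mul_unitarymx.
have U1V : U1 ^t* *m U1 = 1%:M - v ^t* *m v.
  rewrite /U1 trmx_mul map_mxM mulmxA -(mulmxA (U0 ^t*)).
  by rewrite (mulmx1C (unitarymxP Q_unit)) mulmx1.
pose T1 := U1 *m diag_mx (\row_i z i) *m U1 ^t*.
have {}T_trig : is_trig_mx T1.
  by move: T_trig; rewrite /T1 /U1 trmx_mul map_mxM !mulmxA.
have := char_poly_compression z U1_unit v_unit U1V.
rewrite sum_prod (char_poly_trig T_trig) => prodE.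
have /tuple_permP[sg E] :
    perm_eq [tuple w i | i < p] [tuple T1 i i | i < p].
  have prod_mktuple (f : 'I_p -> C) :
      \prod_(x <- [tuple f i | i < p]) ('X - x%:P) =
      \prod_(i < p) ('X - (f i)%:P).
    by rewrite big_tuple; apply: eq_bigr => i _; rewrite tnth_mktuple.
  by apply: prod_XsubC_eq; rewrite !prod_mktuple prodE.
exists (row_perm sg U1), (fun i => val (sg i)).
have TE : row_perm sg U1 *m diag_mx (\row_i z i) *m (row_perm sg U1) ^t* =
    mxsub sg sg T1.
  rewrite /T1 mxsub_mul -mul_rowsub_mx row_permEsub; congr (_ *m _).
  by rewrite -(conj_mxsub sg id).
split.
- by move=> i j /val_inj/perm_inj.
- apply/unitarymxP; rewrite row_permEsub -(conj_mxsub sg id) -mxsub_mul.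
  by rewrite (unitarymxP U1_unit); apply/matrixP => i j;
    rewrite !mxE (inj_eq perm_inj).
- rewrite row_permE trmx_mul map_mxM mulmxA -(mulmxA (U1 ^t*)).
  rewrite tr_perm_mx map_perm_mx -perm_mxM mulVg perm_mx1 mulmx1.
  exact: U1V.
- move=> i; rewrite TE mxE.
  have /(congr1 (fun t => tnth t i)) : [tuple w i | i < p] =
    [tuple tnth [tuple T1 i i | i < p] (sg i) | i < p] by apply/val_inj.
  by rewrite !tnth_mktuple.
- by move=> i j ij; rewrite TE mxE (is_trig_mxP T_trig).
Qed.

(** Since U U^* = 1, compressing the diagonal matrix of the X - (lambda z_i + mu) gives (X - mu) -
    lambda T, again triangular for [h]. Hence the same weights serve every [lambda] and [mu]. *)
Lemma prod_affine_compression (C : numClosedFieldType) (p n k : nat)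
    (U : 'M[C]_(p, n)) (h : 'I_p -> nat) (z : 'I_n -> C) (w : 'I_p -> C)
    (T := U *m diag_mx (\row_i z i) *m U ^t*) (r : 'I_k -> 'I_p)
    (lambda mu : C) :
  injective h -> U \is unitarymx -> (forall i, T i i = w i) ->
  (forall i j, (h i < h j)%N -> T i j = 0) -> injective r ->
  \prod_(i < k) ('X - (lambda * w (r i) + mu)%:P) =
  \sum_(s in incr_tuples n k) (minor_weight U r (tnth s))%:P *
    \prod_(i < k) ('X - (lambda * z (tnth s i) + mu)%:P).
Proof.
move=> h_inj /unitarymxP UU T_diag T_trig r_inj.
rewrite -(det_compression polyC U (fun j => 'X - (lambda * z j + mu)%:P)).
have -> : \row_i ('X - (lambda * z i + mu)%:P) =
    const_mx ('X - mu%:P) - lambda%:P *: map_mx polyC (\row_i z i)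
      :> 'rV[{poly C}]_n.
  by apply/rowP => i; rewrite !mxE polyCD polyCM opprD addrA addrAC.
rewrite linearB linearZ /= diag_const_mx mulmxBr mulmxBl mul_mx_scalar.
rewrite -scalemxAr -!scalemxAl -map_diag_mx -!map_mxM UU -/T map_mx1 scalemx1.
clearbody T.
rewrite (det_mxsub_trig h_inj r_inj) => [|i j ij].
  apply: eq_bigr => i _; rewrite !mxE eqxx mulr1n T_diag.
  by rewrite polyCD polyCM opprD addrA addrAC.
rewrite !mxE T_trig // mulr0 subr0.
by case: eqP ij => // ->; rewrite ltnn.
Qed.

(** * Vieta's formula and the zeros of the rational function *)

Lemma esym_affineE (R : rcfType) (n k m : nat) (x : 'I_n -> R[i])
    (lambda mu : R[i]) (s : k.-tuple 'I_n) :
  (m <= k)%N ->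
  esym_affine m x lambda mu s =
  (-1) ^+ m *
    (\prod_(i < k) ('X - (lambda * x (tnth s i) + mu)%:P))`_(k - m).
Proof.
move=> le_mk.
pose cs := [tuple lambda * x (tnth s i) + mu | i < k].
have -> : \prod_(i < k) ('X - (lambda * x (tnth s i) + mu)%:P) =
    \prod_(c <- cs) ('X - c%:P).
  by rewrite big_tuple; apply: eq_bigr => i _; rewrite tnth_mktuple.
have /= -> := mroots_coeff cs (Ordinal (le_mk : m < k.+1)%N).
rewrite mulrA -expr2 sqrr_sign mul1r; apply: mpoly.meval_eq => i.
by rewrite tnth_mktuple.
Qed.

Lemma pole_sumE (R : rcfType) (p : nat) (a : 'I_p.+1 -> R)
    (z : 'I_p.+1 -> R[i]) :
  pole_sum a z =
  tofrac (\sum_i ((a i)%:C%C)%:P * \prod_(j < p) ('X - (z (lift i j))%:P)) /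
  tofrac (\prod_i ('X - (z i)%:P)).
Proof.
rewrite /pole_sum raddf_sum mulr_suml; apply: eq_bigr => i _.
rewrite [in RHS](bigD1_ord i) //= !tofracM -mulf_div divff ?mulr1 //.
by rewrite tofrac_eq0; apply/prodf_neq0 => j _; rewrite polyXsubC_eq0.
Qed.

(** The numerator is monic of degree p because the [a i] sum to 1, and it is nonzero at each pole,
    so nothing cancels. Its roots are then exactly the [w j], with multiplicity. *)
Lemma pole_sum_zeros (R : rcfType) (p : nat) (a : 'I_p.+1 -> R)
    (z : 'I_p.+1 -> R[i]) (w : 'I_p -> R[i]) :
  injective z -> (forall i, a i != 0) -> \sum_i a i = 1 ->
  zeros_of (pole_sum a z) w ->
  \sum_i ((a i)%:C%C)%:P * \prod_(j < p) ('X - (z (lift i j))%:P) =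
  \prod_(j < p) ('X - (w j)%:P).
Proof.
move=> z_inj a_neq0 sum_a; rewrite pole_sumE => w_zeros.
pose Q (i : 'I_p.+1) := \prod_(j < p) ('X - (z (lift i j))%:P).
set N := \sum_i _; pose D := \prod_i ('X - (z i)%:P).
have Q_size i : size (Q i) = p.+1.
  by rewrite /Q -big_enum size_prod_XsubC size_enum_ord.
have Q_monic i : Q i \is monic by apply: monic_prod_XsubC.
have N_p : N`_p = 1.
  rewrite -[N]/(\sum_i ((a i)%:C%C)%:P * Q i).
  rewrite coef_sum -[RHS](rmorph1 (real_complex R)) -sum_a rmorph_sum.
  apply: eq_bigr => i _; rewrite coefCM.
  by have /monicP := Q_monic i; rewrite lead_coefE Q_size => ->; rewrite mulr1.
have N_size : (size N <= p.+1)%N.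
  apply: (leq_trans (size_sum _ _ _)); apply/bigmax_leqP => i _.
  by rewrite mul_polyC (leq_trans (size_scale_leq _ _)) ?Q_size.
have N_lead : lead_coef N = 1.
  rewrite lead_coefE (_ : size N = p.+1) //; apply/eqP.
  rewrite eqn_leq N_size ltnNge; apply/negP => N_small.
  by move: N_p; rewrite nth_default // => /eqP; rewrite eq_sym oner_eq0.
have N_neq0 : N != 0 by rewrite -lead_coef_eq0 N_lead oner_neq0.
have D_neq0 : D != 0.
  by apply/prodf_neq0 => j _; rewrite polyXsubC_eq0.
have [rs defN] := closed_field_poly_normal N.
rewrite N_lead scale1r in defN.
have mup_N c : #|[set j | w j == c]| = mup c N.
  (* If c is some z_i, only the i-th summand of [N] survives there and [N] does not vanish; the
     truncated subtraction then gives 0 on both sides. *)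
  rewrite w_zeros zero_multE //; case: (boolP (root D c)) => [|Dc]; last first.
    by rewrite (mupNroot Dc) subn0.
  rewrite /root horner_prod prodf_seq_eq0 => /hasP[i _ /=].
  rewrite hornerXsubC subr_eq0 => /eqP ->.
  rewrite (@mupNroot _ _ N) // /root horner_sum (bigD1 i) //=.
  rewrite [X in _ + X]big1 => [|j ji].
    rewrite addr0 hornerCM horner_prod mulf_neq0 //.
      by rewrite fmorph_eq0.
    apply/prodf_neq0 => j _; rewrite hornerXsubC subr_eq0 (inj_eq z_inj).
    exact: neq_lift.
  have [l -> _] := unlift_some ji.
  rewrite hornerCM horner_prod (bigD1 l) //= hornerXsubC subrr.
  by rewrite mul0r mulr0.
rewrite defN -(big_map w xpredT (fun c => 'X - c%:P)); apply: perm_big.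
apply/allP => c _ /=; rewrite -mu_prod_XsubC -defN -mup_N.
rewrite count_map -sum1_count -sum1_card.
by apply/eqP/eq_bigl => j; rewrite inE.
Qed.

(** * Sums indexed in lexicographic order *)

Lemma lex_tuple_inj (n k : nat) : injective (@lex_tuple n k).
Proof.
have le_lex (i j : 'I_('C(n, k))) : lex_tuple i = lex_tuple j -> (j <= i)%N.
  by move=> eq_ij; rewrite leqNgt -lex_tuple_lt eq_ij ltxx.
by move=> i j eq_ij; apply/val_inj/anti_leq; rewrite !le_lex.
Qed.

Lemma imset_lex_tuple (n k : nat) :
  incr_tuples n k = [set lex_tuple i | i : 'I_('C(n, k))].
Proof.
apply/esym/eqP; rewrite eqEcard; apply/andP; split.
  by apply/fintype.subsetP => _ /imsetP[i _ ->]; apply: Order.enum_valP.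
by rewrite card_incr_tuples (card_imset _ (@lex_tuple_inj n k)) card_ord.
Qed.

Lemma big_lex_tuple (V : nmodType) (n k : nat) (F : k.-tuple 'I_n -> V) :
  \sum_(i < 'C(n, k)) F (lex_tuple i) = \sum_(s in incr_tuples n k) F s.
Proof.
by rewrite imset_lex_tuple big_imset //= => i j _ _ /lex_tuple_inj.
Qed.

Lemma lex_tuple_incr (n k : nat) (i : 'I_('C(n, k))) :
  lex_tuple i \in incr_tuples n k.
Proof. by rewrite imset_lex_tuple imset_f. Qed.

(** * Jensen's inequality for finite sums *)

Lemma convex_pair (R : realType) (Phi : Rcomplex R -> R) (t : R)
    (x y : Rcomplex R) :
  @convex_function R (Rcomplex R) [set: Rcomplex R]%classic Phi ->
  0 <= t -> t <= 1 ->
  Phi (t *: x + (1 - t) *: y) <= t * Phi x + (1 - t) * Phi y.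
Proof.
move=> Phi_convex t_ge0 t_le1.
exact: (Phi_convex (Itv01 t_ge0 t_le1) x y (mem_set I) (mem_set I)).
Qed.

(* The mass missing from the weights is put on an extra point [y], so that the
   induction needs no normalization. *)
Lemma jensen_defect (R : realType) (Phi : Rcomplex R -> R) (I : Type)
    (s : seq I) (c : I -> R) (x : I -> Rcomplex R) (y : Rcomplex R) :
  @convex_function R (Rcomplex R) [set: Rcomplex R]%classic Phi ->
  (forall i, 0 <= c i) -> \sum_(i <- s) c i <= 1 ->
  Phi ((1 - \sum_(i <- s) c i) *: y + \sum_(i <- s) c i *: x i) <=
  (1 - \sum_(i <- s) c i) * Phi y + \sum_(i <- s) c i * Phi (x i).
Proof.
move=> Phi_convex c_ge0; elim: s y => [|i s IHs] y.
  by rewrite !big_nil !subr0 scale1r addr0 mul1r addr0.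
rewrite !big_cons; set S := \sum_(j <- s) c j => le1.
have S_ge0 : 0 <= S by apply: sumr_ge0.
have S_le1 : S <= 1 by apply: le_trans le1; rewrite lerDr.
have [S1|S_neq1] := eqVneq S 1.
  have -> : c i = 0.
    by apply/le_anti; rewrite c_ge0 andbT -(lerD2r S) add0r [X in _ <= X]S1.
  by rewrite !add0r scale0r mul0r !add0r; apply: IHs.
have S_lt1 : 0 < 1 - S by rewrite subr_gt0 lt_neqAle S_neq1.
(* The points [x i] and [y] merge into one of weight [1 - S], in which [t] is the share of [x i];
   the induction hypothesis is applied to the merged point. *)
pose t := c i / (1 - S).
have t_ge0 : 0 <= t by rewrite divr_ge0 // ltW.
have t_le1 : t <= 1 by rewrite ler_pdivrMr // mul1r lerBrDr.
have tE : (1 - S) * t = c i by rewrite mulrC divfK // gt_eqF.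
have tE' : (1 - S) * (1 - t) = 1 - (c i + S).
  by rewrite mulrBr mulr1 tE opprD addrA addrAC.
clearbody t; have := IHs (t *: x i + (1 - t) *: y) S_le1; rewrite -/S.
rewrite scalerDr !scalerA tE tE' addrA [_ *: y + c i *: _]addrC => /le_trans.
apply; rewrite addrA lerD2r [X in _ <= X]addrC -tE' -tE -!mulrA -mulrDr.
by apply: ler_wpM2l; [exact: ltW|exact: convex_pair].
Qed.

Lemma jensen (R : realType) (Phi : Rcomplex R -> R) (I : finType)
    (A : {pred I}) (c : I -> R) (x : I -> R[i]) :
  @convex_function R (Rcomplex R) [set: Rcomplex R]%classic Phi ->
  (forall i, 0 <= c i) -> \sum_(i in A) c i = 1 ->
  Phi (\sum_(i in A) (c i)%:C%C * x i) <= \sum_(i in A) c i * Phi (x i).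
Proof.
move=> Phi_convex c_ge0; rewrite -!big_enum /= => c_sum.
(* The extra point 0 is arbitrary: its weight vanishes. *)
have := @jensen_defect R Phi I (enum A) c x 0 Phi_convex c_ge0.
rewrite c_sum lexx => /(_ isT).
rewrite subrr scale0r mul0r !add0r; congr (Phi _ <= _).
by apply: eq_bigr => i _; case: (x i) => b d; simpc.
Qed.

(** * Construction of the weights and the conclusion *)

Lemma esym_weights (R : rcfType) (p k : nat) (z : 'I_p.+1 -> R[i])
    (a : 'I_p.+1 -> R) (w : 'I_p -> R[i]) :
  (0 < p)%N -> injective z -> (forall i, 0 < a i) -> \sum_i a i = 1 ->
  zeros_of (pole_sum a z) w ->
  exists P : k.-tuple 'I_p -> k.-tuple 'I_p.+1 -> R,
    [/\ forall r s, 0 <= P r s,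
        forall r, r \in incr_tuples p k ->
          \sum_(s in incr_tuples p.+1 k) P r s = 1,
        forall s, s \in incr_tuples p.+1 k ->
          \sum_(r in incr_tuples p k) P r s =
          1 - \sum_(i < k) a (tnth s i) &
        forall m lambda mu r, (m <= k)%N -> r \in incr_tuples p k ->
          esym_affine m w lambda mu r =
          \sum_(s in incr_tuples p.+1 k)
            (P r s)%:C%C * esym_affine m z lambda mu s].
Proof.
move=> p_gt0 z_inj a_gt0 a_sum w_zeros.
pose v : 'rV[R[i]]_p.+1 := \row_i (Num.sqrt (a i))%:C%C.
have vE i : v 0 i * (v 0 i)^* = (a i)%:C%C.
  rewrite mxE conj_Creal ?complex_real // -rmorphM /= -expr2 sqr_sqrtr //.
  exact: ltW.
have v_unit : v \is unitarymx.
  apply/unitarymxP/matrixP => i j; rewrite !ord1 !mxE eqxx.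
  rewrite -[RHS](rmorph1 (real_complex R)) -a_sum rmorph_sum.
  by apply: eq_bigr => l _; apply: etrans (vE l); rewrite !mxE.
have := pole_sum_zeros z_inj (fun i => lt0r_neq0 (a_gt0 i)) a_sum w_zeros.
under eq_bigr do rewrite -vE.
case/(triangular_compression p_gt0 v_unit) => U [h [h_inj U_unit UV Td Tt]].
(* A squared modulus is a nonnegative complex number, so its real part loses nothing. *)
pose P (r : k.-tuple 'I_p) (s : k.-tuple 'I_p.+1) : R :=
  complex.Re (minor_weight U (tnth r) (tnth s)).
have PE r s : (P r s)%:C%C = minor_weight U (tnth r) (tnth s).
  by rewrite RRe_real // ger0_real // minor_weight_ge0.
have C_inj := fmorph_inj (real_complex R).
exists P; split=> [r s|r r_incr|s s_incr|m lambda mu r le_mk r_incr].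
- by rewrite -lecR PE minor_weight_ge0.
- apply: C_inj; rewrite rmorph_sum rmorph1 /=.
  under eq_bigr do rewrite PE.
  (* With the diagonal equal to 1, the row sum becomes a principal minor of U U^* = 1. *)
  have := det_compression idfun U (fun=> 1) (tnth r).
  under [RHS]eq_bigr do rewrite big1 ?mulr1 //=.
  move=> <-; rewrite [map_mx _ U]map_mx_id // [map_mx _ (U ^t*)]map_mx_id //.
  have -> : \row__ 1 = const_mx 1 :> 'rV[R[i]]_p.+1.
    by apply/rowP => i; rewrite !mxE.
  rewrite diag_const_mx mulmx1 (unitarymxP U_unit) -[RHS](det1 _ k).
  by congr (\det _); apply/matrixP => i j; rewrite !mxE
    (inj_eq (incr_tuple_inj r_incr)).
- apply: C_inj; rewrite rmorph_sum rmorphB rmorph1 rmorph_sum /=.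
  under eq_bigr do rewrite PE.
  rewrite sum_minor_weight UV det_mxsub_proj; last exact: incr_tuple_inj.
  by congr (_ - _); apply: eq_bigr => i _; rewrite vE.
rewrite esym_affineE //.
rewrite (@prod_affine_compression R[i] _ _ _ _ _ z _ _ _ _ h_inj U_unit Td Tt);
  last exact: incr_tuple_inj.
rewrite coef_sum mulr_sumr; apply: eq_bigr => s _.
by rewrite esym_affineE // coefCM PE mulrCA.
Qed.

Theorem corollary3 (R : realType) (n : nat) (z : 'I_n -> R[i]) (a : 'I_n -> R)
    (w : 'I_n.-1 -> R[i])
    (hn : (2 <= n)%N)
    (hz : injective z)
    (ha : forall i, 0 < a i)
    (ha1 : \sum_(i < n) a i = 1)
    (hw : zeros_of (pole_sum a z) w) :
  forall k : nat, (1 <= k <= n.-1)%N ->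
    (exists Rk : 'M[R]_('C(n.-1, k), 'C(n, k)),
      row_stochastic Rk /\
      (forall (m : nat) (lambda mu : R[i]), (1 <= m <= k)%N -> lambda != 0 ->
         (esym_row k m w lambda mu)^T =
           map_mx (real_complex R) Rk *m (esym_row k m z lambda mu)^T) /\
      bvec k a = avec R n k *m Rk) /\
    (forall (m : nat) (lambda mu : R[i]) (Phi : Rcomplex R -> R),
       (1 <= m <= k)%N -> lambda != 0 ->
       @convex_function R (Rcomplex R) [set: Rcomplex R]%classic Phi ->
       \sum_(r in incr_tuples n.-1 k) Phi (esym_affine m w lambda mu r) <=
       \sum_(s in incr_tuples n k)
          (1 - \sum_(i < k) a (tnth s i)) *
            Phi (esym_affine m z lambda mu s)).
Proof.
move=> k /andP[k_gt0 k_le].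
case: n z a w hn hz ha ha1 hw k_le => [//|p] z a w.
rewrite /= => p_gt0 z_inj a_gt0 a_sum w_zeros k_le.
have [P [P_ge0 P_row P_col P_esym]] :=
  @esym_weights R p k z a w p_gt0 z_inj a_gt0 a_sum w_zeros.
split=> [|m lambda mu Phi /andP[_ m_le] _ Phi_convex].
  exists (\matrix_(i, j) P (lex_tuple i) (lex_tuple j)); split; last split.
  - split=> [i j|i]; first by rewrite mxE.
    under eq_bigr do rewrite mxE.
    by rewrite (big_lex_tuple (P (lex_tuple i))) P_row // lex_tuple_incr.
  - move=> m lambda mu /andP[_ m_le] _; apply/matrixP => i j.
    rewrite !mxE P_esym // ?lex_tuple_incr //.
    by rewrite -big_lex_tuple; apply: eq_bigr => l _; rewrite !mxE.
  - apply/rowP => j; rewrite !mxE -P_col ?lex_tuple_incr // mulr_sumr.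
    rewrite -big_lex_tuple.
    by apply: eq_bigr => i _; rewrite !mxE.
(* Each coefficient on the right is a column sum of [P]; exchanging the sums reduces the claim to
   Jensen's inequality in each row. *)
under [leRHS]eq_bigr => s s_incr do rewrite -P_col // mulr_suml.
rewrite exchange_big /=; apply: ler_sum => r r_incr.
by rewrite P_esym //; apply: jensen => //; apply: P_row.
Qed.
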